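(* If $\Gamma$ is a Coxeter graph of spherical type, then the Artin group $A_\Gamma$ is right-orderable if and only if the corresponding Artin monoid $A_\Gamma^+$ is right-orderable.
   Context: A Coxeter matrix over a finite set $S$ is a symmetric matrix $(m_{st})_{s,t\in S}$ with $m_{ss}=1$ and $m_{st}\in\{2,3,\dots,\infty\}$ for $s\ne t$; its Coxeter graph $\Gamma$ has vertex set $S$, an edge $\{s,t\}$ when $m_{st}\ge3$, labelled by $m_{st}$ when $m_{st}\ge4$. The Coxeter group is $W_\Gamma=\langle s\in S:(st)^{m_{st}}=1 \text{ if } m_{st}<\infty\rangle$ (including $s^2=1$); $\Gamma$ is of spherical type if $W_\Gamma$ is finite. Let $\Sigma$ be a set in bijection with $S$ and write $\langle ab\rangle^q=aba\cdots$ ($q$ factors). The Artin group $A_\Gamma$ is the group with generators $\Sigma$ and relations $\langle ab\rangle^{m_{ab}}=\langle ba\rangle^{m_{ab}}$ for $a\ne b$ in $\Sigma$ with $m_{ab}<\infty$; the Artin monoid $A_\Gamma^+$ is the monoid given by the same presentation, read as a monoid presentation. A group or monoid $G$ is right-orderable if there is a strict linear ordering $<$ of its elements with $g<h\Rightarrow gk<hk$ for all $g,h,k\in G$. *)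

(* Defs.v *)
From HB Require Import structures.
From mathcomp Require Import all_boot.
From mathcomp Require Import boolp classical_sets functions cardinality.

Set Implicit Arguments.
Unset Strict Implicit.
Unset Printing Implicit Defensive.

Local Open Scope quotient_scope.
Local Open Scope group_scope.

Section PresentedMonoid.
Variables (X : choiceType) (R : seq X -> seq X -> Prop).

Inductive word_cong : seq X -> seq X -> Prop :=
| word_cong_refl u : word_cong u u
| word_cong_sym u v : word_cong u v -> word_cong v u
| word_cong_trans u v w : word_cong u v -> word_cong v w -> word_cong u w
| word_cong_step p q u v : R u v -> word_cong (p ++ u ++ q) (p ++ v ++ q).

Lemma word_cong_ctx p q u v :
  word_cong u v -> word_cong (p ++ u ++ q) (p ++ v ++ q).
Proof.
elim=> {u v} [u|u v _|u v w _ uv _|p' q' u v Ruv].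
- exact: word_cong_refl.
- exact: word_cong_sym.
- exact: word_cong_trans.
- have := word_cong_step (p ++ p') (q' ++ q) Ruv.
  by rewrite -!catA.
Qed.

Lemma word_cong_cat u u' v v' :
  word_cong u u' -> word_cong v v' -> word_cong (u ++ v) (u' ++ v').
Proof.
move=> uu' vv'; apply: (@word_cong_trans _ (u' ++ v)).
  exact: (@word_cong_ctx [::] v u u').
by have := @word_cong_ctx u' [::] v v' vv'; rewrite !cats0.
Qed.

Definition word_congb : rel (seq X) := fun u v => `[< word_cong u v >].

Fact word_congb_refl : reflexive word_congb.
Proof. by move=> u; apply/asboolP/word_cong_refl. Qed.

Fact word_congb_sym : symmetric word_congb.
Proof. by move=> u v; apply/asboolP/asboolP => /word_cong_sym. Qed.

Fact word_congb_trans : transitive word_congb.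
Proof.
move=> v u w /asboolP uv /asboolP vw.
exact/asboolP/(word_cong_trans uv).
Qed.

Canonical word_cong_equiv :=
  EquivRel word_congb word_congb_refl word_congb_sym word_congb_trans.

Definition presented_monoid := {eq_quot word_cong_equiv}.

HB.instance Definition _ : EqQuotient _ word_cong_equiv presented_monoid :=
  EqQuotient.on presented_monoid.
HB.instance Definition _ := Choice.on presented_monoid.

Lemma presented_monoidP u v :
  \pi_presented_monoid u = \pi_presented_monoid v <-> word_cong u v.
Proof.
split=> [/eqP|uv]; first by rewrite eqmodE => /asboolP.
by apply/eqP; rewrite eqmodE; apply/asboolP.
Qed.

Definition presented_mul (x y : presented_monoid) : presented_monoid :=
  \pi_presented_monoid (repr x ++ repr y).

Lemma presented_mulE u v :
  presented_mul (\pi_presented_monoid u) (\pi_presented_monoid v)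
    = \pi_presented_monoid (u ++ v).
Proof.
apply/presented_monoidP/word_cong_cat;
  by apply/presented_monoidP; rewrite reprK.
Qed.

Fact presented_mulA : associative presented_mul.
Proof.
elim/quotW=> u; elim/quotW=> v; elim/quotW=> w.
by rewrite (presented_mulE v w) (presented_mulE u v) !presented_mulE catA.
Qed.

Fact presented_mul1 : left_id (\pi_presented_monoid [::]) presented_mul.
Proof. by elim/quotW=> u; rewrite presented_mulE. Qed.

Fact presented_mulr1 : right_id (\pi_presented_monoid [::]) presented_mul.
Proof. by elim/quotW=> u; rewrite presented_mulE cats0. Qed.

HB.instance Definition _ := isMonoid.Build presented_monoid
  presented_mulA presented_mul1 presented_mulr1.

End PresentedMonoid.

Section PresentedGroup.
Variables (X : choiceType) (R : seq X -> seq X -> Prop).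

(* The letter [(x, b)] stands for the generator [x] when [b] is [false] and
   for its inverse when [b] is [true]. *)
Definition pos_word (u : seq X) : seq (X * bool) := [seq (x, false) | x <- u].

Inductive group_rel : seq (X * bool) -> seq (X * bool) -> Prop :=
| group_rel_pos u v : R u v -> group_rel (pos_word u) (pos_word v)
| group_rel_cancel x b : group_rel [:: (x, b); (x, ~~ b)] [::].

Definition presented_group := presented_monoid group_rel.

HB.instance Definition _ := Quotient.on presented_group.
HB.instance Definition _ := Monoid.on presented_group.

Definition inv_word (w : seq (X * bool)) : seq (X * bool) :=
  rev [seq (l.1, ~~ l.2) | l <- w].

Local Notation cong := (word_cong group_rel).

Fact inv_wordK : involutive inv_word.
Proof.
move=> w; rewrite /inv_word map_rev revK -map_comp -[RHS]map_id.
by apply: eq_map => -[x b] /=; rewrite negbK.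
Qed.

Fact cong_mul_inv w : cong (w ++ inv_word w) [::].
Proof.
elim: w => [|[x b] w IHw]; first exact: word_cong_refl.
rewrite /inv_word /= rev_cons -cats1.
apply: (@word_cong_trans _ _ _ [:: (x, b); (x, ~~ b)]).
  have := word_cong_ctx [:: (x, b)] [:: (x, ~~ b)] IHw.
  by rewrite -!catA.
by have := word_cong_step [::] [::] (group_rel_cancel x b).
Qed.

Fact cong_inv_mul w : cong (inv_word w ++ w) [::].
Proof. by have := cong_mul_inv (inv_word w); rewrite inv_wordK. Qed.

Fact cong_inv u v : cong u v -> cong (inv_word u) (inv_word v).
Proof.
move=> uv; apply: (@word_cong_trans _ _ _ (inv_word u ++ v ++ inv_word v)).
  rewrite -[X in cong X _]cats0; apply: word_cong_cat (word_cong_refl _ _) _.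
  exact/word_cong_sym/cong_mul_inv.
apply: (@word_cong_trans _ _ _ (inv_word u ++ u ++ inv_word v)).
  by apply: word_cong_ctx; apply: word_cong_sym.
rewrite catA -[X in cong _ X]cat0s.
by apply: word_cong_cat (word_cong_refl _ _); apply: cong_inv_mul.
Qed.

Lemma presented_groupP u v :
  \pi_presented_group u = \pi_presented_group v <-> cong u v.
Proof. exact: presented_monoidP. Qed.

Definition presented_inv (x : presented_group) : presented_group :=
  \pi_presented_group (inv_word (repr x)).

Lemma presented_invE u :
  presented_inv (\pi_presented_group u) = \pi_presented_group (inv_word u).
Proof.
by apply/presented_groupP/cong_inv/presented_groupP; rewrite reprK.
Qed.

Fact presented_mulVg :
  left_inverse 1 presented_inv (@mul presented_group).
Proof.
elim/quotW=> u; rewrite presented_invE; apply: etrans (presented_mulE _ _ _) _.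
exact/presented_groupP/cong_inv_mul.
Qed.

Fact presented_mulgV :
  right_inverse 1 presented_inv (@mul presented_group).
Proof.
elim/quotW=> u; rewrite presented_invE; apply: etrans (presented_mulE _ _ _) _.
exact/presented_groupP/cong_mul_inv.
Qed.

HB.instance Definition _ := hasInv.Build presented_group presented_inv.
HB.instance Definition _ := Monoid_isGroup.Build presented_group
  presented_mulVg presented_mulgV.

End PresentedGroup.

(* [None] encodes the value oo. A Coxeter graph with vertex set [S] and its
   Coxeter matrix are the same data (no edge when the entry is 2, an unlabelled
   edge when it is 3, an edge labelled by the entry otherwise), so a Coxeter
   graph is represented by its matrix. *)
Record coxeter_matrix (S : finType) := CoxeterMatrix {
  coxeter_entry :> S -> S -> option nat;
  coxeter_entry_sym : forall s t, coxeter_entry s t = coxeter_entry t s;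
  coxeter_entry_diag : forall s, coxeter_entry s s = Some 1%N;
  coxeter_entry_off : forall s t m,
    s != t -> coxeter_entry s t = Some m -> (2 <= m)%N
}.

(* <ab>^q = aba... with q letters *)
Fixpoint alternating (X : Type) (a b : X) (q : nat) : seq X :=
  if q is q'.+1 then a :: alternating b a q' else [::].

Section CoxeterArtin.
Variables (S : finType) (M : coxeter_matrix S).

(* The case s = t, m = 1 is the relation s^2 = 1. *)
Inductive coxeter_rel : seq S -> seq S -> Prop :=
| CoxeterRel s t m : M s t = Some m ->
    coxeter_rel (flatten (nseq m [:: s; t])) [::].

Inductive artin_rel : seq S -> seq S -> Prop :=
| ArtinRel a b m : a != b -> M a b = Some m ->
    artin_rel (alternating a b m) (alternating b a m).

Definition coxeter_group : groupType := presented_group coxeter_rel.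

Definition spherical_type : Prop := finite_set [set: coxeter_group].

Definition artin_group : groupType := presented_group artin_rel.

Definition artin_monoid : monoidType := presented_monoid artin_rel.

End CoxeterArtin.

Definition right_orderable (G : monoidType) : Prop :=
  exists lt : rel G,
    [/\ irreflexive lt,
        transitive lt,
        (forall g h : G, g != h -> lt g h || lt h g)
      & forall g h k : G, lt g h -> lt (g * k) (h * k)].

(* Main.v *)
(* A right order on the group restricts to the monoid as soon as the monoid
   embeds in the group, and a right order on the monoid extends to a group of
   fractions. Both follow once the Artin monoid has a central, cancellable
   element C divisible by every generator: then the group is the localization
   of the monoid at C, and an order on the monoid extends by comparing C^n g
   and C^n h for n large.

   C is the square of the lift of the longest element w0 of the Coxeter group W
   along the section rho : W -> A^+ given by Matsumoto's theorem. To cancel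
   rho w0, let W act on W * A^+ as left multiplication does on factorizations
   rho w * x whose first factor is the greatest reduced one: v sends (w, x) to
   (v y, rho (y^-1 w) x), where y is the longest prefix of w such that v y is
   reduced. The braid relations hold for this action, so the monoid acts, and
   w0 sends (w, x) to (w0, rho w * x), from which rho w * x can be read off.

   The existence of y and of w0 is a Newman-type confluence argument in the weak
   order. It uses only the rank two parabolic subgroups, together with the fact
   that s t has order exactly m_st, which is seen on a representation of W. *)
From mathcomp Require Import all_boot order ssralg ssrnum poly.
From mathcomp Require Import algC cyclotomic ring zify.
From mathcomp Require Import boolp classical_sets functions cardinality.
Require Import Defs.

Set Implicit Arguments.
Unset Strict Implicit.
Unset Printing Implicit Defensive.

Import GRing.Theory.
Local Open Scope quotient_scope.
Local Open Scope group_scope.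

(** * The order of a product of two Coxeter generators *)

Section NumbersGame.
Local Open Scope ring_scope.
Variables (F : fieldType) (S : eqType) (c : S -> S -> F).

(** When [c] is minus twice the bilinear form, this is the simple reflection acting on the dual of
    the reflection representation, a vector [f] being given by its values on the simple roots. *)
Definition fire (s : S) (f : S -> F) : S -> F := fun u => f u + c s u * f s.

Lemma fireK s : c s s = -2 -> involutive (fire s).
Proof. by move=> cs f; apply/funext => u; rewrite /fire cs; ring. Qed.

(* With [c s t = z + z^-1] the successive fired values satisfy
   [x_(k+1) = (z + z^-1) x_k - x_(k-1)], hence [x_k = A z^k + B z^(-k)]; the
   last branch adds up the even and the odd ones. *)
Lemma fire_iter s t (z A B : F) f k : s != t -> z != 0 -> z ^+ 2 != 1 ->
    c s s = -2 -> c t t = -2 -> c s t = z + z^-1 -> c t s = z + z^-1 ->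
    f t = A + B -> f s = - (A / z + B * z) ->
  let X := z ^+ (2 * k) in
  foldr fire f (flatten (nseq k [:: s; t])) = fun u =>
    if u == t then A * X + B / X
    else if u == s then - (A * X / z + B * z / X)
    else f u + c t u * (A * ((X - 1) / (z ^+ 2 - 1))
                        + B * ((X^-1 - 1) / (z ^- 2 - 1)))
             + c s u * (A * z * ((X - 1) / (z ^+ 2 - 1))
                        + B / z * ((X^-1 - 1) / (z ^- 2 - 1))).
Proof.
move=> st z0 z1 css ctt cst cts ft fs; elim: k => [|k IHk] /=.
  rewrite muln0 expr0; apply/funext => u; case: eqP => [->|_].
    by rewrite ft mulr1 divr1.
  case: eqP => [->|_]; first by rewrite fs !mulr1 divr1.
  by rewrite invr1 subrr !mul0r !mulr0 !addr0 !mulr0 !addr0.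
rewrite IHk; set X := z ^+ _ in IHk *.
have X0 : X != 0 by rewrite expf_neq0.
have -> : z ^+ (2 * k.+1) = X * z ^+ 2 by rewrite mulnS addnC exprD.
have z3 : 1 - z ^+ 2 != 0 by rewrite subr_eq0 eq_sym.
have z4 : z ^+ 2 - 1 != 0 by rewrite subr_eq0.
have ts : t != s by rewrite eq_sym.
apply/funext => u; rewrite /fire !eqxx (negPf st).
have [->|ut] := eqVneq u t; last have [->|us] := eqVneq u s.
- by rewrite ctt cst cts; field; apply/andP.
- by rewrite css cts; field; apply/andP.
- by rewrite cts; field; rewrite z0 mulN1r z3 X0 z4.
Qed.

(** For [A = 1] and [B = 0] the values form a pure geometric progression, so the powers of [z]
    detect the powers of the product of the two moves. *)
Lemma fire_iter1 s t (z : F) k : s != t -> z != 0 -> z ^+ 2 != 1 ->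
    c s s = -2 -> c t t = -2 -> c s t = z + z^-1 -> c t s = z + z^-1 ->
  let f u := if u == t then 1 else - z^-1 in
  foldr fire f (flatten (nseq k [:: s; t])) t = z ^+ (2 * k).
Proof.
move=> st z0 z1 css ctt cst cts f.
rewrite (@fire_iter s t z 1 0) ?eqxx ?mul1r ?mul0r ?addr0//.
  by rewrite /f eqxx.
by rewrite /f (negPf st).
Qed.

End NumbersGame.

Lemma presented_monoid_action (X : choiceType) (R : seq X -> seq X -> Prop)
    (T : Type) (act : X -> T -> T) :
  (forall u v, R u v -> forall x, foldr act x u = foldr act x v) ->
  forall u v, \pi_(presented_monoid R) u = \pi_(presented_monoid R) v ->
  forall x, foldr act x u = foldr act x v.
Proof.
move=> actR u v /presented_monoidP; elim=> {u v} [//|u v _ IH x|u v w _ IHu _ IHv x|].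
- by rewrite IH.
- by rewrite IHu.
- by move=> p q u v Ruv x; rewrite !foldr_cat (actR _ _ Ruv).
Qed.

Lemma presented_monoidM (X : choiceType) (R : seq X -> seq X -> Prop) u v :
  \pi_(presented_monoid R) (u ++ v)
  = \pi_(presented_monoid R) u * \pi_(presented_monoid R) v.
Proof. by symmetry; apply: presented_mulE. Qed.

Lemma presented_groupM (X : choiceType) (R : seq X -> seq X -> Prop) u v :
  \pi_(presented_group R) (u ++ v)
  = \pi_(presented_group R) u * \pi_(presented_group R) v.
Proof. exact: presented_monoidM. Qed.

Lemma presented_group_genV (X : choiceType) (R : seq X -> seq X -> Prop) a :
  \pi_(presented_group R) [:: (a, true)]
  = (\pi_(presented_group R) [:: (a, false)])^-1.
Proof. by symmetry; apply: (presented_invE _ [:: (a, false)]). Qed.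

(** * Words in the generators and the Coxeter group *)

Section Evaluation.
Variables (S : finType) (M : coxeter_matrix S).
Local Notation W := (coxeter_group M).

Definition ev (u : seq S) : W :=
  \pi_(presented_group (coxeter_rel M)) (pos_word u).

Lemma ev_nil : ev [::] = 1. Proof. by []. Qed.

Lemma ev_cat u v : ev (u ++ v) = ev u * ev v.
Proof. by rewrite /ev /pos_word map_cat presented_groupM. Qed.

Lemma ev_cons s u : ev (s :: u) = ev [:: s] * ev u.
Proof. by rewrite -ev_cat. Qed.

Lemma ev_rel s t m : M s t = Some m -> ev (flatten (nseq m [:: s; t])) = 1.
Proof.
move=> Mst; apply/presented_monoidP.
have := word_cong_step [::] [::] (group_rel_pos (CoxeterRel Mst)).
by rewrite /= !cats0.
Qed.

Lemma ev_gen2 s : ev [:: s] * ev [:: s] = 1.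
Proof. by rewrite -ev_cat; apply: (ev_rel (coxeter_entry_diag M s)). Qed.

Lemma ev_genV s : (ev [:: s])^-1 = ev [:: s].
Proof. exact: mulg1_eq (ev_gen2 s). Qed.

Lemma ev_rev u : ev (rev u) = (ev u)^-1.
Proof.
elim: u => [|s u IH]; first by rewrite ev_nil invg1.
by rewrite rev_cons -cats1 ev_cat IH (ev_cons s u) invgM ev_genV.
Qed.

Lemma ev_surj w : exists u, ev u = w.
Proof.
elim/quotW: w => w; exists [seq l.1 | l <- w].
elim: w => [//|[s b] w IH] /=; rewrite ev_cons IH.
rewrite -(cat1s (s, b)) presented_groupM; congr (_ * _); case: b => //.
by rewrite -ev_genV presented_group_genV.
Qed.

(** An inverse letter is made to act like its generator. The diagonal entries, covered by the
    hypothesis with [m = 1], make each letter an involution, which yields the cancellation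
    relations. *)
Lemma ev_action (T : Type) (act : S -> T -> T) :
  (forall s t m, M s t = Some m -> forall x,
     foldr act x (flatten (nseq m [:: s; t])) = x) ->
  forall u v, ev u = ev v -> forall x, foldr act x u = foldr act x v.
Proof.
move=> actM u v euv x.
have fE y w : foldr act y w = foldr (fun l => act l.1) y (pos_word w).
  by elim: w => //= s w ->.
have act2 s : involutive (act s) := actM s s 1%N (coxeter_entry_diag M s).
rewrite !fE.
apply: (presented_monoid_action (R := group_rel (coxeter_rel M))) => // {u v euv x}.
move=> _ _ [u v [s t m Mst] x|s b x]; first by rewrite -fE actM.
exact: act2.
Qed.

End Evaluation.

Section OrderOfProduct.
Local Open Scope ring_scope.
Variables (S : finType) (M : coxeter_matrix S).

(* The entry oo gets 2, which is not a root of unity; the junk entry 0, which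
   does not occur, gets 2 as well. *)
Definition coxeter_root (o : option nat) : algC :=
  if o is Some m.+1 then sval (C_prim_root_exists (ltn0Sn (2 * m).+1)) else 2.

Lemma coxeter_root_neq0 o : coxeter_root o != 0.
Proof.
have two0 : 2 != 0 :> algC by rewrite Num.Theory.pnatr_eq0.
by case: o => [[|m]|] //=; case: C_prim_root_exists => z /= /prim_root_eq0 ->.
Qed.

Lemma coxeter_root_exp m : (0 < m)%N -> coxeter_root (Some m) ^+ (2 * m) = 1.
Proof.
case: m => // m _ /=; case: C_prim_root_exists => z /= /prim_expr_order.
by rewrite mulnS addnC addn2.
Qed.

Lemma coxeter_root_exp1 o k : coxeter_root o ^+ (2 * k) = 1 ->
  k = 0%N \/ exists2 m, o = Some m & (m %| k)%N.
Proof.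
have two : (2 : algC) ^+ (2 * k) = 1 -> k = 0%N.
  case: k => // k e; suff : 1 < 2 ^+ (2 * k.+1) :> algC.
    by rewrite e Order.POrderTheory.ltxx.
  by rewrite -natrX Num.Theory.ltr1n -(expn0 2) ltn_exp2l.
case: o => [[|m]|] /= => [/two|| /two]; [by left| |by left].
case: C_prim_root_exists => z /= zP /eqP; rewrite -(prim_order_dvd zP).
by rewrite -addn2 [X in (X %| _)%N]addnC -mulnS dvdn_pmul2l// => mk; right; exists m.+1.
Qed.

(** Minus twice the Tits form, with [2 cos(pi/m)] replaced by [z + z^-1] for some primitive [2m]-th
    root of unity [z], hence possibly by a Galois conjugate; the entry oo gives [5/2]. *)
Definition coxeter_form (s t : S) : algC :=
  if s == t then -2 else coxeter_root (M s t) + (coxeter_root (M s t))^-1.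

Lemma coxeter_root_sqr s t : s != t -> coxeter_root (M s t) ^+ 2 != 1.
Proof.
move=> st; apply/eqP => /(@coxeter_root_exp1 _ 1) [//|[m Mst]].
by rewrite dvdn1 => /eqP m1; move: (coxeter_entry_off st Mst); rewrite m1.
Qed.

Lemma coxeter_form_off s t : s != t ->
  coxeter_form s t = coxeter_root (M s t) + (coxeter_root (M s t))^-1.
Proof. by rewrite /coxeter_form => /negPf ->. Qed.

Lemma coxeter_form_sym s t : coxeter_form s t = coxeter_form t s.
Proof. by rewrite /coxeter_form eq_sym coxeter_entry_sym. Qed.

Lemma fire_coxeter s t m f : M s t = Some m ->
  foldr (fire coxeter_form) f (flatten (nseq m [:: s; t])) = f.
Proof.
have c2 u : coxeter_form u u = -2 by rewrite /coxeter_form eqxx.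
have [<-|st] := eqVneq s t.
  by rewrite coxeter_entry_diag => -[<-] /=; apply: fireK.
move=> Mst; set z := coxeter_root (M s t).
have z0 : z != 0 := coxeter_root_neq0 _.
have z2 : z ^+ 2 - 1 != 0 by rewrite subr_eq0; apply: coxeter_root_sqr.
have z3 : 1 - z ^+ 2 != 0 by rewrite -opprB oppr_eq0.
have zm : z ^+ (2 * m) = 1.
  by rewrite /z Mst coxeter_root_exp// ltnW// (coxeter_entry_off st Mst).
(* The solution of [A + B = f t], [A / z + B * z = - f s], which exists because [z^2 != 1]. *)
pose B := (f t + z * f s) / (1 - z ^+ 2); pose A := f t - B.
have cst := coxeter_form_off st.
rewrite (@fire_iter _ _ _ s t z A B) ?(coxeter_form_sym t)//; first last.
- by rewrite /A /B; field; rewrite ?mulN1r ?z0 ?z3.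
- by rewrite /A subrK.
- by rewrite -subr_eq0.
rewrite zm invr1 subrr; apply/funext => u; rewrite !(mulr1, mul0r, mulr0, addr0).
case: eqP => [->|_]; first by rewrite /A subrK.
case: eqP => [->|//]; rewrite /A /B; field.
by rewrite ?mulN1r ?z0 ?z3.
Qed.

(** Acting by [(st)^k] turns the value [1] at [t] of the function from [fire_iter1] into [z^(2k)],
    while the relation fixes that value. So [z^(2k) = 1], and the order of [z] decides. *)
Lemma ev_gen_order s t k : s != t -> ev M (flatten (nseq k [:: s; t])) = 1%g ->
  k = 0%N \/ exists2 m, M s t = Some m & (m %| k)%N.
Proof.
move=> st e; apply: coxeter_root_exp1.
set z := coxeter_root (M s t).
have z0 : z != 0 := coxeter_root_neq0 _.
have c2 u : coxeter_form u u = -2 by rewrite /coxeter_form eqxx.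
have cst := coxeter_form_off st.
pose f u : algC := if u == t then 1 else - z^-1.
rewrite -(@fire_iter1 _ _ coxeter_form s t z) ?(coxeter_form_sym t) ?coxeter_root_sqr//.
rewrite (@ev_action _ M _ _ (fun s t m e x => fire_coxeter x e) _ [::] e) /=.
by case: eqP.
Qed.

End OrderOfProduct.

(** * Length and the exchange condition *)

Section Length.
Variables (S : finType) (M : coxeter_matrix S).
Local Notation W := (coxeter_group M).
Local Notation ev := (ev M).
Local Notation gen s := (ev [:: s]).

Fact len_exists (w : W) : exists n, `[< exists2 u, ev u = w & size u = n >].
Proof. by have [u <-] := ev_surj w; exists (size u); apply/asboolP; exists u. Qed.

Definition len (w : W) : nat := ex_minn (len_exists w).

Lemma len_ev u : len (ev u) <= size u.
Proof.
by rewrite /len; case: ex_minnP => n _; apply; apply/asboolP; exists u.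
Qed.

Lemma reduced_word w : exists2 u, ev u = w & size u = len w.
Proof. by rewrite /len; case: ex_minnP => n /asboolP[u]; exists u. Qed.

Lemma len1 : len 1 = 0.
Proof. by apply/eqP; rewrite -leqn0 -[1]/(ev [::]) len_ev. Qed.

Lemma len_eq0 w : len w = 0 -> w = 1.
Proof. by have [u <- <-] := reduced_word w => /size0nil ->. Qed.

Lemma lenM v w : len (v * w) <= len v + len w.
Proof.
have [[u <- <-] [u' <- <-]] := (reduced_word v, reduced_word w).
by rewrite -ev_cat -size_cat len_ev.
Qed.

Lemma lenV w : len w^-1 = len w.
Proof.
have lenV_le v : len v^-1 <= len v.
  by have [u <- <-] := reduced_word v; rewrite -ev_rev -(size_rev u) len_ev.
by apply/eqP; rewrite eqn_leq lenV_le -{1}[w]invgK lenV_le.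
Qed.

Lemma genK s : involutive (mul (gen s)).
Proof. by move=> w; rewrite mulgA ev_gen2 mul1g. Qed.

(* The bit records the parity of the number of times the gallery of a word
   crosses the wall of a reflection. *)
Definition cross (s : S) (x : W * bool) : W * bool :=
  (gen s * x.1 * gen s, x.2 (+) (x.1 == gen s)).

Lemma foldr_cross1 u r e : (foldr cross (r, e) u).1 = ev u * r * (ev u)^-1.
Proof.
elim: u => [|s u IH] /=; first by rewrite ev_nil invg1 mulg1 mul1g.
by rewrite IH (ev_cons M s u) invgM ev_genV !mulgA.
Qed.

Lemma foldr_cross2 u r e :
  (foldr cross (r, e) u).2 = e (+) (foldr cross (r, false) u).2.
Proof.
elim: u => [|s u IH] /=; first by rewrite addbF.
by rewrite IH !foldr_cross1 addbA.
Qed.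

Lemma ev_nseq s t k : ev (flatten (nseq k [:: s; t])) = (gen s * gen t) ^+ k.
Proof.
by elim: k => // k IH; rewrite /= expgS -IH (ev_cat _ [:: s; t]) (ev_cat _ [:: s]).
Qed.

(* Along [(s t)^k] the reflection [r] is crossed at step [j] exactly when
   [r = t (s t)^j]. *)
Lemma foldr_cross_nseq s t k r e :
  (foldr cross (r, e) (flatten (nseq k [:: s; t]))).2
  = e (+) odd (count (fun j => r == gen t * (gen s * gen t) ^+ j) (iota 0 (2 * k))).
Proof.
set p := gen s * gen t.
have pV j : gen t * p ^+ j = p ^- j * gen t.
  elim: j => [|j IH]; first by rewrite expg0 invg1 mulg1 mul1g.
  by rewrite [in LHS]expgSr mulgA IH expgS !invgM !ev_genV !mulgA.
have conjE (x y z : W) : (x * y * x^-1 == z) = (y == x^-1 * z * x).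
  apply/eqP/eqP => [<-|->]; first by rewrite !mulgA mulVg mul1g mulgVK.
  by rewrite !mulgA mulgV mul1g mulgK.
have gtE y : (gen t * y * gen t == gen s) = (y == gen t * gen s * gen t).
  by rewrite -{2}(ev_genV M t) conjE ev_genV.
elim: k => [|k IH]; first by rewrite muln0 /= addbF.
have -> : (2 * k.+1 = 2 * k + 2)%N by lia.
rewrite iotaD count_cat oddD addbA -IH /= -!addbA; congr (_ (+) _).
rewrite foldr_cross1 ev_nseq -/p /= addn0 oddD !oddb; congr (_ (+) _).
  by rewrite conjE -pV add0n mul2n -addnn expgnDr mulgA.
rewrite gtE conjE !mulgA -pV.
by rewrite -!mulgA [gen s * _]mulgA -/p -expgS -expgnDr addnS add0n mul2n addnn.
Qed.

(** The [2m] elements [t (st)^j] repeat with period [m], so each is met an even number of times and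
    the bit is unchanged. *)
Lemma foldr_cross_coxeter s t m x : M s t = Some m ->
  foldr cross x (flatten (nseq m [:: s; t])) = x.
Proof.
move=> Mst; have pm : (gen s * gen t) ^+ m = 1 by rewrite -ev_nseq (ev_rel Mst).
case: x => r e; rewrite [LHS]surjective_pairing foldr_cross1 foldr_cross_nseq.
rewrite ev_nseq pm mul1g invg1 mulg1 mul2n -addnn iotaD count_cat oddD.
have -> : iota (0 + m) m = map (addn m) (iota 0 m) by rewrite -iotaDl addnC.
rewrite count_map (eq_count (a2 := fun j => r == gen t * (gen s * gen t) ^+ j)).
  by rewrite addbb addbF.
by move=> j /=; rewrite expgnDr pm mul1g.
Qed.

Lemma foldr_cross_ev u v x : ev u = ev v -> foldr cross x u = foldr cross x v.
Proof.
by move=> e; apply: (ev_action (M := M)) e x => s t m Mst x; apply: foldr_cross_coxeter.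
Qed.

(** A set bit has been flipped by some letter [a]; at that moment [r] has been conjugated by [ev q]
    into [gen a]. *)
Lemma foldr_cross_split u r : (foldr cross (r, false) u).2 ->
  exists p a q, u = p ++ a :: q /\ ev q * r = gen a * ev q.
Proof.
elim: u => //= s u IH; case E: (foldr cross (r, false) u).2.
  by move=> _; have [p [a [q [-> e]]]] := IH E; exists (s :: p), a, q.
rewrite foldr_cross1 /= => /eqP e; exists [::], s, u; split=> //.
by rewrite -e mulgVK.
Qed.

(** If [u] crosses the wall of [s] an even number of times, then [us] crosses it an odd number of
    times, and so does a reduced word [v] of [us], since the parity depends only on the element.
    Deleting a letter of [v] then writes [u] with fewer than [len (us)] letters, against the
    hypothesis. *)
Lemma exchange_r u s : len (ev u * gen s) <= len (ev u) ->
  exists p a q, u = p ++ a :: q /\ ev u * gen s = ev (p ++ q).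
Proof.
have exch v : (foldr cross (gen s, false) v).2 ->
    exists p a q, v = p ++ a :: q /\ ev v * gen s = ev (p ++ q).
  move=> /foldr_cross_split[p [a [q [-> e]]]]; exists p, a, q; split=> //.
  by rewrite !ev_cat (ev_cons _ a) -!mulgA e genK.
case E: (foldr cross (gen s, false) u).2; first by move=> _; apply: exch.
have [v vE vs] := reduced_word (ev u * gen s).
have : (foldr cross (gen s, false) v).2.
  have -> : ev v = ev (rcons u s) -> foldr cross (gen s, false) v =
    foldr cross (gen s, false) (rcons u s) by apply: foldr_cross_ev.
    rewrite foldr_rcons /cross /= -/cross ev_gen2 mul1g eqxx.
    by rewrite foldr_cross2 E.
  by rewrite vE -cats1 ev_cat.
move=> /exch[p [a [q [vpq e]]]]; rewrite -vs => le.
have := len_ev (p ++ q); rewrite -e vE -mulgA ev_gen2 mulg1.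
by move: le; rewrite vpq !size_cat /=; lia.
Qed.

Lemma exchange s u : len (gen s * ev u) <= len (ev u) ->
  exists p a q, u = p ++ a :: q /\ gen s * ev u = ev (p ++ q).
Proof.
rewrite -lenV invgM ev_genV -[X in _ <= X]lenV -ev_rev => /exchange_r[p [a [q [uE e]]]].
exists (rev q), a, (rev p); split.
  by rewrite -[u]revK uE rev_cat rev_cons cat_rcons.
by rewrite -rev_cat ev_rev -e invgM ev_genV ev_rev invgK.
Qed.

(** Exchange deletes a letter from a reduced word, so a generator never preserves the length. *)
Lemma len_gen_lt s w : (len (gen s * w) <= len w) = (len (gen s * w) < len w).
Proof.
apply/idP/idP => [|/ltnW//].
have [u <- us] := reduced_word w => /exchange[p [a [q [uE ->]]]].
by rewrite -us uE; apply: leq_ltn_trans (len_ev _) _; rewrite !size_cat /= addnS.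
Qed.

Lemma len_gen s : len (gen s) = 1%N.
Proof.
apply/eqP; rewrite eqn_leq len_ev lt0n; apply/eqP => e.
by have := len_gen_lt s 1; rewrite mulg1 e len1.
Qed.

Lemma len_genM s w :
  len (gen s * w) = (len w).+1 \/ len w = (len (gen s * w)).+1.
Proof.
have := len_gen_lt s w; have := lenM (gen s) w.
by have := lenM (gen s) (gen s * w); rewrite genK len_gen; lia.
Qed.

End Length.

(** * Rank two parabolic subgroups *)

Section Alternating.
Variable X : Type.
Implicit Types a b : X.

Lemma size_alternating a b n : size (alternating a b n) = n.
Proof. by elim: n a b => //= n IH a b; rewrite IH. Qed.

Lemma take_alternating a b n k : k <= n ->
  take k (alternating a b n) = alternating a b k.
Proof. by elim: n k a b => [|n IH] [|k] a b //= kn; rewrite IH. Qed.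

Lemma alternating_rcons a b n :
  alternating a b n.+1 = rcons (alternating a b n) (if odd n then b else a).
Proof.
elim: n a b => // n IH a b; rewrite -[LHS]/(a :: alternating b a n.+1) IH /=.
by case: odd.
Qed.

Lemma rev_alternating a b n :
  rev (alternating a b n) = if odd n then alternating a b n else alternating b a n.
Proof.
elim: n a b => // n IH a b; rewrite [in LHS]alternating_rcons rev_rcons IH /=.
by case: (odd n).
Qed.

End Alternating.

Lemma cat_eq_cat_cons (T : Type) (v u p q : seq T) b : v ++ u = p ++ b :: q ->
  (exists2 q', v = p ++ b :: q' & q = q' ++ u) \/
  (exists2 p', p = v ++ p' & u = p' ++ b :: q).
Proof.
elim: v p => [|a v IH] p /=; first by right; exists p.
case: p => [|c p] /= [<-]; first by left; exists v.
by case/IH=> [[q' -> ->]|[p' -> ->]]; [left; exists q'|right; exists p'].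
Qed.

Section Dihedral.
Variables (S : finType) (M : coxeter_matrix S).
Local Notation W := (coxeter_group M).
Local Notation ev := (ev M).
Local Notation gen s := (ev [:: s]).
Local Notation len := (@len S M).

(** Follows from [s (ts)^k = (st)^k s]; it turns coincidences between alternating words into
    statements on powers of [st]. *)
Lemma ev_alternatingE s t k :
  ev (alternating s t k) = (gen s * gen t) ^+ k * ev (alternating t s k).
Proof.
elim: k s t => [|k IH] s t; first by rewrite expg0 mul1g.
rewrite /= ev_cons (IH t s) expgSr (ev_cons _ t (alternating _ _ _)) -!mulgA genK !mulgA.
congr (_ * _).
elim: k {IH} => [|k IH]; first by rewrite !expg0 mulg1 mul1g.
by rewrite [in LHS]expgSr mulgA IH expgSr -!mulgA.
Qed.

Lemma ev_braid s t m : M s t = Some m ->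
  ev (alternating s t m) = ev (alternating t s m).
Proof. by move=> Mst; rewrite ev_alternatingE -ev_nseq (ev_rel Mst) mul1g. Qed.

(** Otherwise exchange deletes a letter at position [k < q] of the shorter alternating word.
    Comparing prefixes gives [(st)^(k+1) = 1] with [k + 1] below [m_st], contradicting the order of
    [st]. *)
Lemma len_alternating s t q : s != t -> (forall m, M s t = Some m -> q <= m) ->
  len (ev (alternating s t q)) = q.
Proof.
elim: q s t => [|q IH] s t st qm; first by rewrite /= ev_nil len1.
have ts : t != s by rewrite eq_sym.
have IHq : len (ev (alternating t s q)) = q.
  by apply: IH => // m; rewrite coxeter_entry_sym => /qm; lia.
apply/eqP; rewrite eqn_leq -{2}(size_alternating s t q.+1) len_ev /= ev_cons.
rewrite -{1}IHq ltnNge; apply/negP => /exchange[p [a [v [uE e]]]].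
set k := size p; have kq : k < q.
  by rewrite -(size_alternating t s q) uE size_cat /=; lia.
have pE : p = alternating t s k.
  by rewrite -(take_alternating t s (ltnW kq)) uE take_size_cat.
have paE : rcons p a = alternating t s k.+1.
  by rewrite -(take_alternating t s kq) uE -cat_rcons take_size_cat ?size_rcons.
have : ev (alternating s t k.+2) = ev (alternating t s k).
  rewrite -[alternating s t k.+2]/(s :: alternating t s k.+1) -paE -pE.
  move: e; rewrite uE -cat_rcons !(ev_cat _ _ v) mulgA => /mulIg <-.
  exact: ev_cons.
rewrite -[alternating s t k.+2]/([:: s; t] ++ alternating s t k) ev_cat.
rewrite (ev_cons M s [:: t]) ev_alternatingE mulgA -expgS.
rewrite -[X in _ = X]mul1g => /mulIg; rewrite -ev_nseq => /(ev_gen_order st)[//|[m Mst]].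
by move=> /dvdn_leq -/(_ isT); have := qm m Mst; lia.
Qed.

(** * Minimal representatives of parabolic cosets *)

Section Coset.
Variable J : pred S.

Lemma min_coset x : exists v x0, [/\ all J v, x = ev v * x0 &
  forall v', all J v' -> len x0 <= len (ev v' * x0)].
Proof.
have ex : exists n, `[< exists2 v, all J v & len (ev v * x) = n >].
  by exists (len x); apply/asboolP; exists [::] => //; rewrite mul1g.
case: (ex_minnP ex) => n /asboolP[v Jv <-] min.
exists (rev v), (ev v * x); split; first by rewrite all_rev.
  by rewrite ev_rev mulKg.
move=> v' Jv'; apply: min; apply/asboolP; exists (v' ++ v); first by rewrite all_cat Jv'.
by rewrite ev_cat mulgA.
Qed.

(** Minimality is only among words in the letters of [J]; [len_min_coset] with [x0 = 1] shows that
    such words are also reduced in [W]. *)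
Definition reduced_in v := all J v /\
  forall v', all J v' -> ev v' = ev v -> size v <= size v'.

Lemma reduced_in_exists v : all J v -> exists2 v', reduced_in v' & ev v' = ev v.
Proof.
move=> Jv; have ex : exists n, `[< exists2 v', all J v' /\ ev v' = ev v & size v' = n >].
  by exists (size v); apply/asboolP; exists v.
case: (ex_minnP ex) => n /asboolP[v' [Jv' e] <-] min; exists v' => //; split=> // w Jw we.
by apply: min; apply/asboolP; exists w => //; split=> //; rewrite we.
Qed.

Lemma reduced_in_cons a v : reduced_in (a :: v) -> reduced_in v.
Proof.
case=> /= /andP[Ja Jv] min; split=> // v' Jv' e.
have := min (a :: v'); rewrite /= Ja Jv' ltnS; apply => //.
by rewrite ev_cons e -ev_cons.
Qed.

(** If prepending [a] lowers the length, exchange deletes a letter of [v] or of a reduced word of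
    [x0]. The first contradicts that [a :: v] is reduced in [J]; the second makes [v^-1 a v x0]
    shorter than [x0] in the same coset. *)
Lemma len_min_coset x0 v : (forall v', all J v' -> len x0 <= len (ev v' * x0)) ->
  reduced_in v -> len (ev v * x0) = (size v + len x0)%N.
Proof.
move=> min; elim: v => [|a v IH] redv; first by rewrite mul1g.
have IHv := IH (reduced_in_cons redv).
have := len_genM a (ev v * x0); rewrite mulgA -ev_cons IHv => -[//|lt].
have [u uE us] := reduced_word x0; have [/= /andP[Ja Jv] minv] := redv.
have : len (gen a * ev (v ++ u)) <= len (ev (v ++ u)).
  by rewrite ev_cat uE mulgA -ev_cons IHv; lia.
move=> /exchange[p [b [q [vu e]]]].
case: (cat_eq_cat_cons vu) => [[q' vE qE]|[p' pE uE']].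
  suff : size (a :: v) <= size (p ++ q') by rewrite vE /= !size_cat /=; lia.
  apply: minv; first by move: Jv; rewrite vE !all_cat /= => /and3P[-> _ ->].
  by move: e; rewrite qE catA !(ev_cat _ _ u) mulgA -ev_cons => /mulIg.
have : len (ev (p' ++ q)) < len x0.
  by apply: leq_ltn_trans (len_ev _ _) _; rewrite -us uE' !size_cat /=; lia.
rewrite ltnNge => /negP[].
have -> : ev (p' ++ q) = ev (rev v ++ a :: v) * x0.
  move: e; rewrite pE -catA !(ev_cat _ v) uE mulgA -ev_cons => e.
  by rewrite (ev_cat _ (rev v)) -mulgA e ev_rev mulKg.
by apply: min; rewrite all_cat all_rev /= Jv Ja.
Qed.

End Coset.

Definition among s t : pred S := fun u => (u == s) || (u == t).

Lemma amongC s t : among s t =1 among t s.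
Proof. by move=> u; rewrite /among orbC. Qed.

Lemma all_alternating s t n : all (among s t) (alternating s t n).
Proof.
elim: n s t => //= n IH s t; rewrite /among eqxx /= (eq_all (amongC s t)).
exact: IH.
Qed.

Lemma reduced_in_alternating s t q : s != t ->
  (forall m, M s t = Some m -> q <= m) -> reduced_in (among s t) (alternating s t q).
Proof.
move=> st qm; split; first exact: all_alternating.
by move=> v' _ e; rewrite size_alternating -(len_alternating st qm) -e len_ev.
Qed.

Lemma reduced_in_amongC s t v : reduced_in (among s t) v -> reduced_in (among t s) v.
Proof.
case=> Jv min; split; first by rewrite (eq_all (amongC t s)).
by move=> v'; rewrite (eq_all (amongC t s)); apply: min.
Qed.

(** Two equal adjacent letters would cancel, so the two letters must alternate. *)
Lemma reduced_in_amongP s t v : reduced_in (among s t) v ->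
  v = alternating s t (size v) \/ v = alternating t s (size v).
Proof.
elim: v => [|a v IH] redv; first by left.
have := redv.1 => /= /andP[aJ _].
have neq_a w : v <> a :: w.
  move=> vE; have [/= /and3P[_ _ Jw] min] : reduced_in (among s t) [:: a, a & w] by rewrite -vE.
  have := min w Jw; rewrite /= (ev_cons _ a) (ev_cons _ a w) genK => /(_ erefl).
  by lia.
have {}IH := IH (reduced_in_cons redv).
case: v IH neq_a aJ {redv} => [|b v] /=.
  by move=> _ _ /orP[]/eqP ->; [left|right].
move=> vE neq_a aJ; have {}neq_a : b <> a by move=> ba; apply: (neq_a v); rewrite ba.
case: vE => -[bE ->]; rewrite size_alternating; move: neq_a aJ; rewrite bE => ba.
  by case/orP=> /eqP ae; [case: ba|right; rewrite ae].
by case/orP=> /eqP ae; [left; rewrite ae|case: ba].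
Qed.

Lemma coset_among s t x : exists v x0, [/\ reduced_in (among s t) v, x = ev v * x0 &
  forall v', reduced_in (among s t) v' -> len (ev v' * x0) = (size v' + len x0)%N].
Proof.
have [v [x0 [Jv -> min]]] := min_coset (among s t) x.
have [v' red <-] := reduced_in_exists Jv.
by exists v', x0; split=> // w; apply: len_min_coset.
Qed.

(** Such an [x] is minimal in its coset: a nonempty [v] in [x = v x0] would make its first letter a
    descent of [x]. *)
Lemma len_alternatingM s t q x : s != t -> (forall m, M s t = Some m -> q <= m) ->
  len x < len (gen s * x) -> len x < len (gen t * x) ->
  len (ev (alternating s t q) * x) = (q + len x)%N.
Proof.
move=> st qm sx tx; have [[|a v] [x0 [red xE lenE]]] := coset_among s t x.
  rewrite xE mul1g lenE ?size_alternating//; exact: reduced_in_alternating.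
have : len x < len (gen a * x).
  by have := red.1 => /= /andP[/orP[]/eqP -> _].
rewrite xE lenE// (ev_cons _ a v) -mulgA genK lenE //=; first by lia.
exact: reduced_in_cons red.
Qed.

(** Write [x = v x0] with [v] alternating from [a], and let [b] be the other letter. If [v] were
    shorter than [m_st], then [bv] would be reduced and [b] no descent. If it were longer, a braid
    relation after its first letter would create the factor [aa]. So [v] has length exactly
    [m_st]. *)
Lemma descents_alternating s t x : s != t ->
  len (gen s * x) < len x -> len (gen t * x) < len x ->
  exists2 m, M s t = Some m & len x = (m + len ((ev (alternating s t m))^-1 * x))%N.
Proof.
move=> st sx tx; have [v [x0 [red xE lenE]]] := coset_among s t x.
have [a [b [ab ax bx vE]]] : exists a b, [/\ (a, b) = (s, t) \/ (a, b) = (t, s),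
    len (gen a * x) < len x, len (gen b * x) < len x & v = alternating a b (size v)].
  by case: (reduced_in_amongP red) => e; [exists s, t|exists t, s]; split=> //; [left|right].
have neq_ab : a != b by case: ab => -[-> ->] //; rewrite eq_sym.
have Mab : M a b = M s t by case: ab => -[-> ->] //; rewrite coxeter_entry_sym.
have {}red : reduced_in (among a b) v.
  by case: ab => -[-> ->] //; apply: reduced_in_amongC.
have {}lenE w : reduced_in (among a b) w -> len (ev w * x0) = (size w + len x0)%N.
  by move=> redw; apply: lenE; case: ab redw => -[-> ->] // /reduced_in_amongC.
have [[m Mst km]|small] : (exists2 m, M s t = Some m & m <= size v) \/
    (forall m, M s t = Some m -> size v < m).
- case: (M s t) => [m|]; last by right.
  by case: (leqP m (size v)) => le; [left; exists m|right => _ [<-]].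
- exists m => //.
  have -> : ev (alternating s t m) = ev (alternating a b m).
    by case: ab => -[-> ->] //; apply: ev_braid.
  have m1 : 1 < m by apply: coxeter_entry_off Mst.
  suff kE : size v = m by rewrite {2}xE mulgA vE kE mulVg mul1g xE lenE// kE.
  apply/eqP; rewrite eqn_leq km andbT leqNgt; apply/negP => lt.
  case: v vE {xE} red lt {km} => // c v /= [-> vE] red; rewrite ltnS => mv.
  case: m m1 Mst mv => // m _ Mst mv; rewrite -Mab in Mst.
  have vE' : v = alternating b a m.+1 ++ drop m.+1 v.
    by rewrite -[LHS](cat_take_drop m.+1) {1}vE take_alternating.
  suff : size (a :: v) <= size (alternating b a m ++ drop m.+1 v).
    by rewrite size_cat size_drop size_alternating /=; lia.
  case: red => Jv; apply.
    move: Jv; rewrite /= all_cat => /andP[_ Jv]; apply/andP; split.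
      by rewrite (eq_all (amongC a b)) all_alternating.
    by move: Jv; rewrite {1}vE' all_cat => /andP[].
  rewrite (ev_cons _ a v) [in RHS]vE' !ev_cat -(ev_braid Mst).
  by rewrite (ev_cons _ a (alternating _ _ _)) -mulgA genK.
- have redb : reduced_in (among a b) (b :: v).
    rewrite vE; have := @reduced_in_alternating b a (size v).+1.
    rewrite eq_sym => /(_ neq_ab) red'; apply: reduced_in_amongC; apply: red' => m.
    by rewrite coxeter_entry_sym Mab => /small.
  by move: bx; rewrite xE mulgA -ev_cons !lenE //= addSn ltnNge leqnSn.
Qed.

End Dihedral.

(** * Reduced lifts and the Garside element *)

Section ReducedLift.
Variables (S : finType) (M : coxeter_matrix S).
Local Notation W := (coxeter_group M).
Local Notation ev := (ev M).
Local Notation gen s := (ev [:: s]).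
Local Notation len := (@len S M).

Definition art (u : seq S) : artin_monoid M := \pi_(presented_monoid (artin_rel M)) u.

Lemma art_cat u v : art (u ++ v) = art u * art v.
Proof. exact: presented_monoidM. Qed.

Lemma art_cons s u : art (s :: u) = art [:: s] * art u.
Proof. by rewrite -art_cat. Qed.

Lemma art_surj x : exists u, art u = x.
Proof. by elim/quotW: x => u; exists u. Qed.

Lemma art_braid s t m : s != t -> M s t = Some m ->
  art (alternating s t m) = art (alternating t s m).
Proof.
move=> st Mst; apply/presented_monoidP.
by have := word_cong_step [::] [::] (ArtinRel st Mst); rewrite /= !cats0.
Qed.

Lemma reduced_cons s u : len (ev (s :: u)) = size (s :: u) ->
  len (ev u) = size u.
Proof.
rewrite ev_cons => e; apply/eqP; rewrite eqn_leq len_ev.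
by have := lenM (gen s) (ev u); rewrite e len_gen.
Qed.

(** Words with the same first letter are handled by induction on their tails. If the first letters
    [s], [t] differ, both are descents, so the element has reduced words [<st>^m r] and [<ts>^m r].
    One shares its first letter with [u], the other with [v], and a braid relation links them. *)
Lemma matsumoto u v : len (ev u) = size u -> len (ev v) = size v ->
  ev u = ev v -> art u = art v.
Proof.
have [n] := ubnP (size u); elim: n => // n IH in u v *.
have same a x y : size x < n -> len (ev (a :: x)) = size (a :: x) ->
    len (ev (a :: y)) = size (a :: y) -> ev (a :: x) = ev (a :: y) ->
    art (a :: x) = art (a :: y).
  move=> xn /reduced_cons redx /reduced_cons redy e.
  rewrite art_cons [RHS]art_cons; congr (_ * _); apply: IH => //.
  by move: e; rewrite ev_cons (ev_cons _ a y) => /mulgI.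
move=> un redu redv uv; have size_uv : size u = size v by rewrite -redu uv.
case: u v => [|s x] [|t y] // in un redu redv uv size_uv *.
have [st|st] := eqVneq s t.
  by rewrite st in un redu uv *; apply: same.
have [sx ty] : gen s * ev (s :: x) = ev x /\ gen t * ev (s :: x) = ev y.
  by split; [rewrite (ev_cons _ s x)|rewrite uv (ev_cons _ t y)]; rewrite genK.
have [||[|m] Mst e] := @descents_alternating _ M s t (ev (s :: x)) st.
- by rewrite sx redu (reduced_cons redu).
- by rewrite ty redu (reduced_cons redv) size_uv.
- by have := coxeter_entry_off st Mst.
have [r rE rs] := reduced_word ((ev (alternating s t m.+1))^-1 * ev (s :: x)).
have xE : ev (s :: x) = ev (alternating s t m.+1 ++ r) by rewrite ev_cat rE mulVKg.
have yE : ev (t :: y) = ev (alternating t s m.+1 ++ r).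
  by rewrite -uv xE ev_cat (ev_braid Mst) ev_cat.
have size_r a b : size (alternating a b m.+1 ++ r) = len (ev (s :: x)).
  by rewrite size_cat size_alternating rs e.
transitivity (art (alternating s t m.+1 ++ r)).
  by apply: same => //; rewrite -/(alternating s t m.+1 ++ r) -xE size_r.
rewrite art_cat (art_braid st Mst) -art_cat.
apply: same => //.
- by rewrite -ltnS -[_.+1]/(size (alternating t s m.+1 ++ r)).+1 size_r redu.
- by rewrite -yE size_r uv.
Qed.

Definition rho (w : W) : artin_monoid M := art (s2val (cid2 (reduced_word w))).

Lemma rho_ev u : len (ev u) = size u -> rho (ev u) = art u.
Proof.
rewrite /rho; case: cid2 => v /= vE vs redu.
by apply: matsumoto => //; rewrite vE.
Qed.

Lemma rho1 : rho 1 = 1.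
Proof. by rewrite -(ev_nil M) rho_ev// ev_nil len1. Qed.

Lemma rho_gen s : rho (gen s) = art [:: s].
Proof. by rewrite rho_ev// len_gen. Qed.

Lemma rhoM x y : len (x * y) = (len x + len y)%N -> rho (x * y) = rho x * rho y.
Proof.
have [[u <- us] [v <- vs]] := (reduced_word x, reduced_word y).
rewrite -ev_cat -us -vs -size_cat => red.
by rewrite !rho_ev// art_cat.
Qed.

(** * The weak order and its greatest elements *)

Lemma mulVgM2l (v x y : W) : (v * x)^-1 * (v * y) = x^-1 * y.
Proof. by rewrite invgM mulgA mulgVK. Qed.

Lemma mulVgMA (x y z : W) : (x * y)^-1 * z = y^-1 * (x^-1 * z).
Proof. by rewrite invgM mulgA. Qed.

Lemma mulgKM (v x y : W) : v * x * (x^-1 * y) = v * y.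
Proof. by rewrite mulgA mulgK. Qed.

(** The right weak order: [y] is a prefix of [w], that is, some reduced word of [w] starts with a
    reduced word of [y]. *)
Definition weak_le y w := len w = (len y + len (y^-1 * w))%N.

Lemma len_tri x y z : len (x^-1 * z) <= len (x^-1 * y) + len (y^-1 * z).
Proof. by apply: leq_trans (lenM _ _); rewrite mulgA mulgK. Qed.

Lemma weak_le_refl x : weak_le x x.
Proof. by rewrite /weak_le mulVg len1 addn0. Qed.

Lemma weak_le1 x : weak_le 1 x.
Proof. by rewrite /weak_le invg1 mul1g len1. Qed.

Lemma weak_le_len x y : weak_le x y -> len x <= len y.
Proof. by rewrite /weak_le => ->; rewrite leq_addr. Qed.

Lemma weak_leV x y z : weak_le x y -> weak_le y z ->
  len (x^-1 * z) = (len (x^-1 * y) + len (y^-1 * z))%N.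
Proof.
rewrite /weak_le => xy yz; have := len_tri x y z; have := lenM x (x^-1 * z).
by rewrite mulVKg; lia.
Qed.

Lemma weak_le_trans x y z : weak_le x y -> weak_le y z -> weak_le x z.
Proof. by move=> xy yz; have := weak_leV xy yz; move: xy yz; rewrite /weak_le; lia. Qed.

Lemma weak_le_anti x y : weak_le x y -> weak_le y x -> x = y.
Proof.
rewrite /weak_le => xy yx; have /len_eq0 e : len (x^-1 * y) = 0 by lia.
by apply: (mulgI x^-1); rewrite mulVg e.
Qed.

Lemma weak_leM v x y : len (v * x) = (len v + len x)%N ->
  len (v * y) = (len v + len y)%N -> weak_le (v * x) (v * y) <-> weak_le x y.
Proof. by rewrite /weak_le mulVgM2l => -> ->; lia. Qed.

Lemma lenM_weak_le v x y : weak_le x y -> len (v * y) = (len v + len y)%N ->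
  len (v * x) = (len v + len x)%N.
Proof.
rewrite /weak_le => xy vy; have := lenM v x; have := lenM (v * x) (x^-1 * y).
by rewrite mulgKM; lia.
Qed.

Lemma weak_le_gen z y : weak_le z y -> z <> y ->
  exists s, len (z * gen s) = (len z).+1 /\ weak_le (z * gen s) y.
Proof.
have [u uE us] := reduced_word (z^-1 * y) => zy neq.
case: u uE us => [|s u] uE us.
  by case: neq; apply: (mulgI z^-1); rewrite mulVg -uE ev_nil.
have yE : y = z * gen s * ev u by rewrite -mulgA -ev_cons uE mulVKg.
have e : (z * gen s)^-1 * y = ev u by rewrite yE mulKg.
have lu := len_ev M u; exists s; move: zy; rewrite /weak_le e -us /= => zy.
have := lenM z (gen s); have := lenM (z * gen s) (ev u).
by rewrite len_gen -yE; split; lia.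
Qed.

(** Newman's argument, by descending induction on the length of [z]: boundedness gives termination,
    and joining two covers of [z] inside [P] gives local confluence. *)
Lemma weak_le_max (P : W -> Prop) (L : nat) :
  (forall w, P w -> len w <= L) ->
  (forall y w, weak_le y w -> P w -> P y) ->
  (forall z s t, s != t -> P (z * gen s) -> P (z * gen t) ->
    len (z * gen s) = (len z).+1 -> len (z * gen t) = (len z).+1 ->
    exists d, [/\ P d, weak_le (z * gen s) d & weak_le (z * gen t) d]) ->
  P 1 -> exists2 m, P m & forall y, P y -> weak_le y m.
Proof.
move=> PL Ppre Pjoin P1.
suff max z : P z -> exists m, [/\ P m, weak_le z m &
    forall y, weak_le z y -> P y -> weak_le y m].
  by have [m [Pm _ mP]] := max _ P1; exists m => // y; apply: mP; apply: weak_le1.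
have [n] := ubnP (L - len z); elim: n => // n IH in z * => zn Pz.
have step s : P (z * gen s) -> len (z * gen s) = (len z).+1 ->
    L - len (z * gen s) < n.
  by move=> /PL; lia.
case: (pselect (exists2 s, P (z * gen s) & len (z * gen s) = (len z).+1)) => [|none].
  case=> s Ps ls; have [m [Pm sm mP]] := IH _ (step s Ps ls) Ps.
  have zs : weak_le z (z * gen s) by rewrite /weak_le mulKg len_gen ls addn1.
  exists m; split=> //; first exact: weak_le_trans zs sm.
  move=> y zy Py; case: (pselect (z = y)) => [<-|]; first exact: weak_le_trans zs sm.
  move=> /(weak_le_gen zy)[t [lt ty]].
  have [ts|ts] := eqVneq t s; first by apply: mP => //; rewrite -ts.
  have Pt := Ppre _ _ ty Py.
  (* The element [m'], greatest above [zt], lies above the join [d], hence above [zs], hence below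
     [m]; and [y] lies below [m']. *)
  have [d [Pd td sd]] := Pjoin _ _ _ ts Pt Ps lt ls.
  have [m' [Pm' tm' mP']] := IH _ (step t Pt lt) Pt.
  apply: weak_le_trans (mP' y ty Py) (mP _ _ Pm').
  exact: weak_le_trans sd (mP' d td Pd).
exists z; split=> //; first exact: weak_le_refl.
move=> y zy Py; case: (pselect (z = y)) => [<-|]; first exact: weak_le_refl.
move=> /(weak_le_gen zy)[t [lt ty]]; case: none; exists t => //.
exact: Ppre ty Py.
Qed.

Lemma len_mul_alternating x s t q : s != t -> (forall m, M s t = Some m -> q <= m) ->
  len x < len (x * gen s) -> len x < len (x * gen t) ->
  len (x * ev (alternating s t q)) = (len x + q)%N.
Proof.
move=> st qm xs xt.
rewrite -lenV invgM -ev_rev rev_alternating.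
have [xs' xt'] : len x^-1 < len (gen s * x^-1) /\ len x^-1 < len (gen t * x^-1).
  by rewrite -(ev_genV M s) -(ev_genV M t) -!invgM !lenV.
case: odd; first by rewrite len_alternatingM// lenV addnC.
by rewrite len_alternatingM 1?eq_sym// ?lenV 1?addnC// coxeter_entry_sym.
Qed.

Lemma weak_le_alternating z s t m : s != t -> M s t = Some m ->
  len z < len (z * gen s) -> len z < len (z * gen t) ->
  weak_le (z * gen s) (z * ev (alternating s t m)).
Proof.
move=> st Mst zs zt; have m1 := coxeter_entry_off st Mst.
have e : len (z * ev (alternating s t m)) = (len z + m)%N.
  by apply: len_mul_alternating => // k; rewrite Mst => -[<-].
have lz := lenM z (gen s); rewrite len_gen in lz.
rewrite /weak_le e; case: m m1 {Mst} e => // m _ e.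
have xE : z * ev (alternating s t m.+1) = z * gen s * ev (alternating t s m).
  by rewrite -mulgA -ev_cons.
have := lenM (z * gen s) (ev (alternating t s m)); rewrite xE mulKg -xE e.
by have := len_ev M (alternating t s m); rewrite size_alternating; lia.
Qed.

(** The join of [zs] and [zt] is [z <st>^m]. Here [m_st] is finite, since otherwise the alternating
    word with [L + 1] letters would be reduced. *)
Lemma longest_exists (L : nat) : (forall w, len w <= L) ->
  exists w0, forall y, weak_le y w0.
Proof.
move=> wL; have [//|//|z s t st _ _ zs zt|//|m _ mP] := @weak_le_max (fun _ => True) L.
  have [m Mst] : exists m, M s t = Some m.
    case Mst: (M s t) => [m|]; first by exists m.
    have := wL (ev (alternating s t L.+1)); rewrite len_alternating ?ltnn// => m.
    by rewrite Mst.
  exists (z * ev (alternating s t m)); split=> //.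
    by apply: weak_le_alternating; rewrite // ?zs ?zt.
  rewrite (ev_braid Mst); apply: weak_le_alternating; rewrite ?zs ?zt// 1?eq_sym//.
  by rewrite coxeter_entry_sym.
by exists m => y; apply: mP.
Qed.

(** * The action of the Artin monoid on pairs *)

Fact glue_exists v w : exists y, [/\ weak_le y w, len (v * y) = (len v + len y)%N &
  forall z, weak_le z w -> len (v * z) = (len v + len z)%N -> weak_le z y].
Proof.
pose P y := weak_le y w /\ len (v * y) = (len v + len y)%N.
have [||z s t st [sw vs] [tw vt] zs zt||m [mw vm] mP] := @weak_le_max P (len w).
- by move=> y [/weak_le_len].
- by move=> y z yz [zw vz]; split; [apply: weak_le_trans yz zw|apply: lenM_weak_le yz vz].
- have zP a : len (z * gen a) = (len z).+1 -> weak_le z (z * gen a).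
    by move=> za; rewrite /weak_le mulKg len_gen za addn1.
  have zw := weak_le_trans (zP s zs) sw.
  have vz := lenM_weak_le (zP s zs) vs.
  have desc a : len (z * gen a) = (len z).+1 -> weak_le (z * gen a) w ->
      len (gen a * (z^-1 * w)) < len (z^-1 * w).
    move=> za aw; have := weak_leV (zP a za) aw.
    by rewrite mulKg len_gen mulVgMA ev_genV => ->.
  (* Both [s] and [t] are descents of [z^-1 w], so [z <st>^m] is still a prefix of [w]. *)
  have [m Mst e] := descents_alternating st (desc s zs sw) (desc t zt tw).
  have le_m k : M s t = Some k -> m <= k by rewrite Mst => -[<-].
  have lzm : len (z * ev (alternating s t m)) = (len z + m)%N.
    by apply: len_mul_alternating => //; rewrite ?zs ?zt.
  exists (z * ev (alternating s t m)); split.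
  + split.
      by move: zw; rewrite /weak_le e lzm mulVgMA; lia.
    have up a : len (z * gen a) = (len z).+1 ->
        len (v * (z * gen a)) = (len v + len (z * gen a))%N ->
        len (v * z) < len (v * z * gen a).
      by move=> za va; rewrite -mulgA va za vz addnS ltnSn.
    have -> : v * (z * ev (alternating s t m)) = v * z * ev (alternating s t m).
      by rewrite mulgA.
    rewrite lzm addnA -vz.
    (* Both [s] and [t] lengthen [vz], so its product with [<st>^m] stays reduced. *)
    by apply: len_mul_alternating => //; apply: up.
  + by apply: weak_le_alternating; rewrite // ?zs ?zt.
  + rewrite (ev_braid Mst); apply: weak_le_alternating; rewrite ?zs ?zt// 1?eq_sym//.
    by rewrite coxeter_entry_sym.
- by split; [apply: weak_le1|rewrite mulg1 len1 addn0].
by exists m; split=> // z zw vz; apply: mP.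
Qed.

Definition glue v w : W := sval (cid (glue_exists v w)).

Lemma glue_weak_le v w : weak_le (glue v w) w.
Proof. by rewrite /glue; case: cid => y []. Qed.

Lemma len_glue v w : len (v * glue v w) = (len v + len (glue v w))%N.
Proof. by rewrite /glue; case: cid => y []. Qed.

Lemma glue_max v w z :
  weak_le z w -> len (v * z) = (len v + len z)%N -> weak_le z (glue v w).
Proof. by rewrite /glue; case: cid => y /= [_ _]; apply. Qed.

Lemma glue1 w : glue 1 w = w.
Proof.
apply: weak_le_anti (glue_weak_le _ _) _.
by apply: glue_max (weak_le_refl w) _; rewrite mul1g len1.
Qed.

(** Maximality on each side: [v] times the greatest prefix for [uv] is a candidate for [u];
    conversely the greatest prefix for [u] begins with [v], and removing [v] leaves a candidate for
    [uv]. *)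
Lemma glueM u v w : len (u * v) = (len u + len v)%N ->
  glue u (v * glue v w) = v * glue (u * v) w.
Proof.
move=> uv; have yP := len_glue v w; set y := glue v w in yP *.
have zP := len_glue (u * v) w; set z := glue (u * v) w in zP *.
have vz : len (v * z) = (len v + len z)%N.
  by have := lenM u (v * z); have := lenM v z; rewrite mulgA zP; lia.
have zy : weak_le z y by apply: glue_max vz; apply: glue_weak_le.
have vzt : weak_le (v * z) (glue u (v * y)).
  apply: glue_max; first exact/weak_leM.
  by rewrite mulgA zP uv vz addnA.
have vv : weak_le v (v * y) by rewrite /weak_le mulKg.
have vt : weak_le v (glue u (v * y)) by apply: glue_max.
have tP := len_glue u (v * y); have ty := glue_weak_le u (v * y).
set t := glue u (v * y) in vzt vt tP ty *.
have tE : t = v * (v^-1 * t) by rewrite mulVKg.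
have vt' : len (v * (v^-1 * t)) = (len v + len (v^-1 * t))%N by rewrite mulVKg.
apply: weak_le_anti vzt; rewrite {1}tE; apply/weak_leM => //; apply: glue_max.
  apply: weak_le_trans (glue_weak_le v w); rewrite -/y; apply/(weak_leM vt' yP).
  by rewrite mulVKg.
rewrite -mulgA mulVKg tP uv -addnA; congr (_ + _)%N; exact: vt.
Qed.

(* A pair [(w, x)] stands for [rho w * x], see [rho_glue_act]. *)
Definition glue_act v (p : W * artin_monoid M) : W * artin_monoid M :=
  (v * glue v p.1, rho ((glue v p.1)^-1 * p.1) * p.2).

Lemma glue_act1 p : glue_act 1 p = p.
Proof. by case: p => w x; rewrite /glue_act /= glue1 mul1g mulVg rho1 mul1g. Qed.

Lemma glue_actM u v p : len (u * v) = (len u + len v)%N ->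
  glue_act u (glue_act v p) = glue_act (u * v) p.
Proof.
case: p => w x uv; rewrite /glue_act /= (glueM w uv) mulgA; congr (_, _).
have zy : weak_le (glue (u * v) w) (glue v w).
  have lz := len_glue (u * v) w.
  apply: glue_max (glue_weak_le _ _) _.
  have := lenM u (v * glue (u * v) w); have := lenM v (glue (u * v) w).
  by rewrite mulgA lz; lia.
have e := weak_leV zy (glue_weak_le v w).
by rewrite mulVgM2l mulgA -rhoM mulgKM.
Qed.

Lemma glue_act_ev u p : len (ev u) = size u ->
  foldr (fun s => glue_act (gen s)) p u = glue_act (ev u) p.
Proof.
elim: u => [|s u IH] red /=; first by rewrite ev_nil glue_act1.
have redu := reduced_cons red; rewrite IH// glue_actM -?ev_cons//.
by rewrite red redu len_gen.
Qed.

(** Both sides of a braid relation are reduced words of one element of [W], so by [glue_act_ev] they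
    act alike. *)
Lemma glue_act_art u v p : art u = art v ->
  foldr (fun s => glue_act (gen s)) p u = foldr (fun s => glue_act (gen s)) p v.
Proof.
move=> uv; apply: presented_monoid_action uv p => _ _ [a b m ab Mab] p.
have red c d : c != d -> M c d = Some m -> len (ev (alternating c d m)) = m.
  by move=> cd Mcd; apply: len_alternating => // k; rewrite Mcd => -[<-].
rewrite !glue_act_ev ?size_alternating ?red// 1?eq_sym// 1?coxeter_entry_sym//.
by rewrite (ev_braid Mab).
Qed.

(** Thus the action on [(1, 1)] recovers the element of the monoid. *)
Lemma rho_glue_act u :
  let p := foldr (fun s => glue_act (gen s)) (1, 1) u in rho p.1 * p.2 = art u.
Proof.
elim: u => [|s u] /=; first by rewrite rho1 mul1g.
rewrite art_cons; set p := foldr _ _ _ => <-.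
rewrite rhoM ?len_glue// rho_gen -!mulgA; congr (_ * _); rewrite mulgA -rhoM.
  by rewrite mulVKg.
by rewrite mulVKg; apply: glue_weak_le.
Qed.

(** * The longest element and the Garside element *)

Section Longest.
Variables (w0 : W) (w0P : forall y, weak_le y w0).

(** No element is longer than [w0], so only the trivial factor can be appended with additive
    length. *)
Lemma glue_longest w : glue w0 w = 1.
Proof.
have := len_glue w0 w; have := weak_le_len (w0P (w0 * glue w0 w)).
by move=> le e; apply: (@len_eq0 _ M); lia.
Qed.

Lemma rho_longest_cancel x y : rho w0 * x = rho w0 * y -> x = y.
Proof.
have [u0 u0E u0s] := reduced_word w0.
have red : len (ev u0) = size u0 by rewrite u0E.
have [[u <-] [v <-]] := (art_surj x, art_surj y).
rewrite -u0E rho_ev// -!art_cat => /(@glue_act_art _ _ (1, 1)).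
(* As [glue w0 w = 1], acting by [w0] moves all of [rho w] into the second coordinate, which is then
   [art u], respectively [art v]. *)
rewrite !foldr_cat !(glue_act_ev _ red) u0E /glue_act !glue_longest => -[].
by rewrite !invg1 !mul1g !rho_glue_act.
Qed.

(** Since [w0^-1] is a prefix of [w0] of the same length, the remaining factor [w0 w0] has length
    zero. *)
Lemma longest_sqr : w0 * w0 = 1.
Proof.
have e : len w0 = (len w0 + len (w0 * w0))%N.
  by have := w0P w0^-1; rewrite /weak_le lenV invgK.
by apply: (@len_eq0 _ M); lia.
Qed.

Lemma longestV : w0^-1 = w0.
Proof. exact: mulg1_eq longest_sqr. Qed.

Lemma rho_longestE x : rho x * rho (x^-1 * w0) = rho w0.
Proof. by rewrite -rhoM mulVKg//; apply: w0P. Qed.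

(** Split [rho w0] as [rho (x^-1 w0)] times [rho (w0 x w0)]; the first factor completes [rho x] to
    [rho w0]. *)
Lemma rho_longest_conj x : rho x * rho w0 = rho w0 * rho (w0 * x * w0).
Proof.
rewrite -[in LHS](rho_longestE (x^-1 * w0)) mulgA rho_longestE.
by rewrite invgM invgK longestV.
Qed.

Let garside := rho w0 * rho w0.

Lemma rho_garside y : rho y * garside = garside * rho y.
Proof.
have conj2 : w0 * (w0 * y * w0) * w0 = y.
  by rewrite !mulgA longest_sqr mul1g -mulgA longest_sqr mulg1.
have -> : rho y * garside = rho w0 * (rho w0 * rho (w0 * (w0 * y * w0) * w0)).
  by rewrite mulgA rho_longest_conj -mulgA rho_longest_conj.
by rewrite conj2 mulgA.
Qed.

Lemma garside_central x : garside * x = x * garside.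
Proof.
have [u <-] := art_surj x; elim: u => [|s u IH]; first by rewrite mulg1 mul1g.
by rewrite art_cons mulgA -rho_gen -rho_garside -[LHS]mulgA IH mulgA.
Qed.

Lemma garside_cancel x y : garside * x = garside * y -> x = y.
Proof. by rewrite /garside -!mulgA => /rho_longest_cancel/rho_longest_cancel. Qed.

Lemma garside_div s :
  exists2 c, c * art [:: s] = garside & art [:: s] * c = garside.
Proof.
have e : rho w0 * rho (w0 * gen s) * art [:: s] = garside.
  rewrite /garside -mulgA -rho_gen; congr (_ * _).
  rewrite -[RHS](rho_longestE (w0 * gen s)) invgM -mulgA longestV longest_sqr.
  by rewrite mulg1 ev_genV.
set c := _ * rho (w0 * gen s) in e; exists c => //.
pose d := rho ((gen s)^-1 * w0) * rho w0.
have f : art [:: s] * d = garside by rewrite mulgA -rho_gen rho_longestE.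
(* The left and right cofactors agree: [C c = c C = c s d = C d], and [C] cancels. *)
suff -> : c = d by [].
by apply: garside_cancel; rewrite garside_central -{1}f mulgA e.
Qed.

End Longest.

Lemma garside_exists L : (forall w, len w <= L) ->
  exists C : artin_monoid M, [/\ (forall x, C * x = x * C),
    (forall x y, C * x = C * y -> x = y) &
    (forall s, exists2 c, c * art [:: s] = C & art [:: s] * c = C)].
Proof.
move=> /longest_exists[w0 w0P]; exists (rho w0 * rho w0); split.
- exact: garside_central.
- exact: garside_cancel.
- exact: garside_div.
Qed.

End ReducedLift.

Lemma spherical_len_bounded (S : finType) (M : coxeter_matrix S) :
  spherical_type M -> exists L, forall w : coxeter_group M, len w <= L.
Proof.
move=> /finite_seqP[r rE]; exists (\max_(w <- r) len w) => w.
apply: (@leq_bigmax_seq _ r xpredT (@len S M)) => //.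
by have : [set: coxeter_group M]%classic w by []; rewrite rE.
Qed.

(** * Groups of fractions *)

Section Fractions.
Variables (X : choiceType) (R : seq X -> seq X -> Prop).
Let A := presented_monoid R.
Let G := presented_group R.
Let mon (u : seq X) : A := \pi_(presented_monoid R) u.
Let grp (w : seq (X * bool)) : G := \pi_(presented_group R) w.

Variable C : A.
Hypothesis C_central : forall x, C * x = x * C.
Hypothesis C_cancel : forall x y, C * x = C * y -> x = y.
Hypothesis C_div : forall a, exists2 c, c * mon [:: a] = C & mon [:: a] * c = C.

Definition cofactor a : A := s2val (cid2 (C_div a)).

Lemma cofactorL a : cofactor a * mon [:: a] = C.
Proof. by rewrite /cofactor; case: cid2. Qed.

Lemma cofactorR a : mon [:: a] * cofactor a = C.
Proof. by rewrite /cofactor; case: cid2. Qed.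

Lemma CX_central n x : C ^+ n * x = x * C ^+ n.
Proof. by apply/esym/commuteX. Qed.

Lemma CX_cancel n x y : C ^+ n * x = C ^+ n * y -> x = y.
Proof.
elim: n => [|n IH]; first by rewrite expg0 !mul1g.
by rewrite expgS -!mulgA => /C_cancel/IH.
Qed.

(* The word [w] represents the fraction [C^(- den w) * num w]. *)
Definition num (w : seq (X * bool)) : A :=
  foldr (fun l x => (if l.2 then cofactor l.1 else mon [:: l.1]) * x) 1 w.

Definition den (w : seq (X * bool)) : nat := count snd w.

Lemma num_cat u v : num (u ++ v) = num u * num v.
Proof. by elim: u => [|l u IH]; rewrite /= ?mul1g// IH mulgA. Qed.

Lemma num_pos u : num (pos_word u) = mon u.
Proof.
by elim: u => [//|a u IH]; rewrite /= IH -presented_monoidM.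
Qed.

Lemma den_pos u : den (pos_word u) = 0.
Proof. by elim: u. Qed.

Lemma CXA m n x : C ^+ m * (C ^+ n * x) = C ^+ n * (C ^+ m * x).
Proof. by rewrite !mulgA -!expgnDr addnC. Qed.

(** Equality of fractions with denominators cleared. Transitivity uses cancellation of powers of
    [C]; for a cancelling pair of letters the numerator is [C] and the denominator exponent is
    [1]. *)
Lemma fraction_eq u v : grp u = grp v ->
  C ^+ den v * num u = C ^+ den u * num v.
Proof.
move=> /presented_groupP; elim=> {u v} [//|//|u v w _ uv _ vw|p q u v uv].
  by apply: (@CX_cancel (den v)); rewrite CXA uv CXA vw CXA.
(* Central powers of [C] are moved past the context [p], [q], leaving only the relation itself to
   check. *)
have ctx k x : C ^+ (den p + (k + den q)) * (num p * (x * num q))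
    = C ^+ (den p + den q) * (num p * (C ^+ k * x * num q)).
  rewrite addnCA addnC expgnDr -mulgA; congr (_ * _).
  by rewrite !mulgA CX_central.
rewrite /den !num_cat !count_cat -!/(den _) !ctx; congr (_ * (_ * (_ * _))).
case: uv => {u v} [u v Ruv|a b].
  rewrite !den_pos !num_pos; congr (_ * _); apply/presented_monoidP.
  by have := word_cong_step [::] [::] Ruv; rewrite /= !cats0.
by case: b; rewrite /= ?expg0 ?expg1 !mul1g ?mulg1 ?cofactorL ?cofactorR.
Qed.

Definition incl (x : A) : G := grp (pos_word (repr x)).

Lemma word_cong_pos u v :
  word_cong R u v -> word_cong (group_rel R) (pos_word u) (pos_word v).
Proof.
elim=> {u v} [u|u v _|u v w _ uv _ vw|p q u v Ruv].
- exact: word_cong_refl.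
- exact: word_cong_sym.
- exact: word_cong_trans uv vw.
- rewrite /pos_word !map_cat -!/(pos_word _).
  by apply: word_cong_step; apply: group_rel_pos.
Qed.

Lemma incl_mon u : incl (mon u) = grp (pos_word u).
Proof.
by apply/presented_groupP/word_cong_pos/presented_monoidP; rewrite [LHS]reprK.
Qed.

Lemma mon_surj x : exists u, mon u = x.
Proof. by elim/quotW: x => u; exists u. Qed.

Lemma inclM x y : incl (x * y) = incl x * incl y.
Proof.
have [[u <-] [v <-]] := (mon_surj x, mon_surj y).
rewrite -presented_monoidM !incl_mon /pos_word map_cat; exact: presented_groupM.
Qed.

(** Positive words have denominator exponent [0], so equal fractions have equal numerators. *)
Lemma incl_inj : injective incl.
Proof.
move=> x y; have [[u <-] [v <-]] := (mon_surj x, mon_surj y).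
by rewrite !incl_mon => /fraction_eq; rewrite !den_pos !num_pos !mul1g.
Qed.

Lemma inclC_central g : incl C * g = g * incl C.
Proof.
have comm a : incl C * grp [:: (a, false)] = grp [:: (a, false)] * incl C.
  by rewrite -(incl_mon [:: a]) -!inclM C_central.
elim/quotW: g => w; elim: w => [|[a b] w IH]; first by rewrite mulg1 mul1g.
rewrite -(cat1s (a, b)) presented_groupM mulgA -[RHS]mulgA -IH [RHS]mulgA; congr (_ * _).
case: b; last exact: comm.
have -> := presented_group_genV R a.
by apply/commuteV/comm.
Qed.

Lemma fraction_exists g : exists n x, incl C ^+ n * g = incl x.
Proof.
elim/quotW: g => w; elim: w => [|[a b] w [n [x e]]].
  by exists 0, 1; rewrite expg0 mul1g; symmetry; apply: (incl_mon [::]).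
have inclCn k g : incl C ^+ k * g = g * incl C ^+ k.
  by apply/esym/commuteX/esym/inclC_central.
rewrite -(cat1s (a, b)) presented_groupM; case: b.
  exists n.+1, (cofactor a * x).
  have -> := presented_group_genV R a.
  rewrite inclM -e expgSr -{2}(cofactorL a) inclM incl_mon -!mulgA mulVKg mulgA.
  by rewrite (inclCn n (incl (cofactor a))) -mulgA.
exists n, (mon [:: a] * x).
by rewrite inclM -e incl_mon mulgA (inclCn n (grp [:: (a, false)])) -mulgA.
Qed.

Lemma right_orderable_submonoid : right_orderable G -> right_orderable A.
Proof.
case=> lt [irr tr tot comp]; exists (fun x y => lt (incl x) (incl y)); split.
- by move=> x; apply: irr.
- by move=> y x z; apply: tr.
- by move=> x y xy; apply: tot; rewrite (inj_eq incl_inj).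
- by move=> x y z xy; rewrite !inclM; apply: comp.
Qed.

(** Two elements of the group are compared through their numerators over a common power of [C]; by
    injectivity of [incl] the numerators are determined by that power. *)
Lemma right_orderable_fractions : right_orderable A -> right_orderable G.
Proof.
case=> lt [irr tr tot comp].
have CX n g x k : incl C ^+ n * g = incl x -> incl C ^+ (k + n) * g = incl (C ^+ k * x).
  move=> e; rewrite expgnDr -mulgA e inclM; congr (_ * _); elim: k => [|k IH].
    by rewrite !expg0; symmetry; apply: (incl_mon [::]).
  by rewrite !expgS inclM IH.
(* Centrality turns left multiplication by a power of [C] into right multiplication, so enlarging
   the denominator keeps the order. *)
have compC k x y : lt x y -> lt (C ^+ k * x) (C ^+ k * y).
  by move=> xy; rewrite !CX_central; apply: comp.
pose ltG g h := `[< exists n x y,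
  [/\ incl C ^+ n * g = incl x, incl C ^+ n * h = incl y & lt x y] >].
exists ltG; split.
- move=> g; apply/asboolP => -[n [x [y [-> /incl_inj <-]]]].
  by rewrite irr.
- move=> h g k /asboolP[n [x [y [gx hy xy]]]] /asboolP[m [y' [z [hy' kz yz]]]].
  apply/asboolP; exists (m + n), (C ^+ m * x), (C ^+ n * z); split.
  + exact: CX.
  + by rewrite addnC; apply: CX.
  (* Over the exponent [m + n] the two numerators of the middle element [h] coincide. *)
  + apply: tr (compC m _ _ xy) _; have <- : C ^+ n * y' = C ^+ m * y.
      by apply: incl_inj; rewrite -(CX _ _ _ _ hy) -(CX _ _ _ _ hy') addnC.
    exact: compC.
- move=> g h gh; have [[n [x gx]] [m [y hy]]] := (fraction_exists g, fraction_exists h).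
  have gx' := CX _ _ _ m gx; have hy' := CX _ _ _ n hy; rewrite addnC in hy'.
  have : C ^+ m * x != C ^+ n * y.
    apply: contra gh => /eqP e; rewrite -(inj_eq (mulgI (incl C ^+ (m + n)))).
    by rewrite gx' hy' e.
  by move=> /tot/orP[] xy; apply/orP; [left|right]; apply/asboolP;
    do 3 eexists; split; eauto.
- move=> g h k /asboolP[n [x [y [gx hy xy]]]]; have [m [z kz]] := fraction_exists k.
  have cong u v : incl C ^+ n * u = incl v -> incl C ^+ (n + m) * (u * k) = incl (v * z).
    move=> uv; rewrite inclM -uv -kz expgnDr -!mulgA; congr (_ * _).
    have comm : incl C ^+ m * u = u * incl C ^+ m.
      by apply/esym/commuteX/esym/inclC_central.
    by rewrite mulgA comm mulgA.
  apply/asboolP; exists (n + m), (x * z), (y * z).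
  by split; [apply: cong|apply: cong|apply: comp].
Qed.

End Fractions.

Theorem theorem5p11 (S : finType) (M : coxeter_matrix S) :
  spherical_type M ->
  (right_orderable (artin_group M) <-> right_orderable (artin_monoid M)).
Proof.
move=> /spherical_len_bounded[L /garside_exists[C [Ccentral Ccancel Cdiv]]].
split.
  exact: (right_orderable_submonoid Ccentral Ccancel Cdiv).
exact: (right_orderable_fractions Ccentral Ccancel Cdiv).
Qed.
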